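(* Let $G=(V,E)$ be an $n$-node directed graph in which every node has out-degree at most $d$ (for an integer $d>0$), with node-weight function $w:V\rightarrow\mathbb{R}_{\geq0}$. There is a deterministic CONGEST algorithm that computes a $2d^{2}$-approximation for MWIS in $G$ (an independent set $X'$ of the underlying undirected graph with $2d^2\cdot w(X')\geq OPT(G)$) in $O(d^{2}+\log^{*}n)$ rounds.
   Context: An independent set is a set of nodes no two of which are joined by an edge (in either direction); $OPT(G)$ is the maximum of $w(I)=\sum_{v\in I}w(v)$ over independent sets $I$. The out-degree of $v$ is the number of edges directed out of $v$. CONGEST model: synchronous rounds on the network $G$, unique $O(\log n)$-bit identifiers, $O(\log n)$-bit messages per edge per round (communication allowed in both directions of each edge), with the direction of each edge known to both endpoints; weights representable with $O(\log n)$ bits. *)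

(* Defs.v *)
From mathcomp Require Import all_boot all_order all_algebra.
From mathcomp Require Import reals.
Set Implicit Arguments.
Unset Strict Implicit.
Unset Printing Implicit Defensive.
Import Order.TTheory GRing.Theory Num.Theory.

Definition bitlen (n : nat) : nat := (trunc_log 2 n).+1.

Lemma log_star_ex (n : nat) : exists k, iter k (up_log 2) n <= 1.
Proof.
elim/ltn_ind: n => n IHn; have [n_le1|n_gt1] := leqP n 1; first by exists 0.
have lt_log : up_log 2 n < n.
  rewrite -(prednK (ltnW n_gt1)) ltnS; apply: up_log_min => //.
  by rewrite -{1}(prednK (ltnW n_gt1)); exact: ltn_expl.
by have [k le1] := IHn _ lt_log; exists k.+1; rewrite iterSr.
Qed.

(* [up_log 2] is the binary logarithm rounded up. For natural numbers m and n,
   log2 n <= m iff up_log 2 n <= m, so the rounding does not change the number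
   of iterations needed to reach a value <= 1. *)
Definition log_star (n : nat) : nat := ex_minn (log_star_ex n).

Definition adj (V : finType) (arc : rel V) : rel V :=
  fun u v => arc u v || arc v u.

Definition out_degree (V : finType) (arc : rel V) (v : V) : nat :=
  #|[set u | arc v u]|.

Definition independent (V : finType) (arc : rel V) (I : {set V}) : bool :=
  [forall u in I, forall v in I, ~~ adj arc u v].

Section Weights.
Local Open Scope ring_scope.

Definition set_weight (R : realType) (V : finType) (w : V -> R) (I : {set V}) :
  R := \sum_(v in I) w v.

(* The default value 0 is the weight of the independent set [set0]. *)
Definition opt (R : realType) (V : finType) (arc : rel V) (w : V -> R) : R :=
  \big[Num.max/0]_(I : {set V} | independent arc I) set_weight w I.

(* x has a binary expansion with at most b digits before and at most b digits
   after the binary point. *)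
Definition binary_representable (R : realType) (b : nat) (x : R) : Prop :=
  exists2 k : nat, (k < 2 ^ (b + b))%N & x * 2%:R ^+ b = k%:R.

End Weights.

(* The links of v are numbered from 0: link i of v leads to the i-th element of
   [ports v]. There is one link between two adjacent nodes, even if arcs in both
   directions are present. *)
Definition port_numbering (V : finType) (arc : rel V) (ports : V -> seq V) :
  Prop :=
  forall v, uniq (ports v) /\ ports v =i [pred u | adj arc v u].

(* Nodes initially know the number n of nodes, the out-degree bound d, their own
   identifier and weight, and for each of their links, in port order, whether it
   carries an outgoing arc and whether it carries an incoming arc. Identifiers
   and weights of neighbours are not known initially. *)
Record congest_algorithm (R : Type) := CongestAlgorithm {
  state : Type;
  (* the number of rounds executed, as a function of n and d *)
  rounds : nat -> nat -> nat;
  init : forall (n d ident : nat) (weight : R) (links : seq (bool * bool)),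
    state;
  (* the message sent through a given port *)
  send : state -> nat -> bitseq;
  (* state update from the messages received in a round, in port order *)
  receive : state -> seq bitseq -> state;
  output : state -> bool
}.

Section Execution.
Variables (R : Type) (A : congest_algorithm R).
Variables (V : finType) (arc : rel V) (d : nat) (w : V -> R).
Variables (ident : V -> nat) (ports : V -> seq V).

Definition message_from (st : V -> state A) (u v : V) : bitseq :=
  send (st u) (index v (ports u)).

Fixpoint exec (t : nat) : V -> state A :=
  if t is t'.+1 then
    fun v => receive (exec t' v) [seq message_from (exec t') u v | u <- ports v]
  else
    fun v => init A #|V| d (ident v) (w v)
               [seq (arc v u, arc u v) | u <- ports v].

Definition messages_bounded (b : nat) : Prop :=
  forall t u v, t < rounds A #|V| d -> adj arc u v ->
    size (message_from (exec t) u v) <= b.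

Definition computed_set : {set V} :=
  [set v | output (exec (rounds A #|V| d) v)].

End Execution.

(* Main.v *)
(* Linial's color reduction, run along outgoing arcs only, gives a proper
   coloring with O(d^2) colors in O(log* n) rounds. Splitting the arcs into those of
   increasing and those of decreasing color yields two acyclic orientations of
   depth O(d^2). On an acyclic orientation of out-degree at most d, the local
   ratio algorithm that processes every vertex before its out-neighbors selects
   a set X without arcs inside; its weight is at least the sum of the residual
   weights, which is at least OPT/d and at least w(V)/(d+1). The first bound on
   the increasing arcs, followed by the second one on the decreasing arcs inside
   X, loses a factor d(d+1) <= 2d^2.
   The local ratio algorithm is run by letting all vertices recompute its
   fixed-point equations in every round: along an acyclic orientation the values
   are stable after as many rounds as there are colors. *)
Require Import Defs.
From mathcomp Require Import all_boot all_order all_algebra.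
From mathcomp Require Import reals.
From mathcomp Require Import finfield zify.
Set Implicit Arguments.
Unset Strict Implicit.
Unset Printing Implicit Defensive.
Import Order.TTheory GRing.Theory Num.Theory.

(** * Bit lengths and binary encoding of natural numbers *)

Lemma bitlen_gt0 n : 0 < bitlen n. Proof. by []. Qed.

Lemma ltn_bitlen n : n < 2 ^ bitlen n.
Proof. exact: trunc_log_ltn. Qed.

Lemma bitlen_min k n : 0 < k -> n < 2 ^ k -> bitlen n <= k.
Proof.
case: n => [|n] k_gt0 n_lt; first by rewrite /bitlen trunc_log0.
by rewrite /bitlen -(ltn_exp2l _ _ (ltnSn 1)) (leq_ltn_trans _ n_lt) ?trunc_logP.
Qed.

Lemma leq_bitlen m n : m <= n -> bitlen m <= bitlen n.
Proof. by move=> le_mn; rewrite ltnS leq_trunc_log. Qed.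

Lemma bitlenM m n : bitlen (m * n) <= bitlen m + bitlen n.
Proof. by rewrite bitlen_min // expnD ltn_mul // ltn_bitlen. Qed.

Lemma exp_bitlen_le n : 0 < n -> 2 ^ bitlen n <= 2 * n.
Proof. by move=> n_gt0; rewrite expnS leq_mul2l trunc_logP. Qed.

Lemma bitlen_up_log n : bitlen n <= 2 * maxn 1 (up_log 2 n).
Proof.
apply: (@leq_trans (maxn 1 (up_log 2 n)).+1); last by lia.
rewrite bitlen_min // expnS (leq_ltn_trans (up_logP n (ltnSn 1))) //.
rewrite (leq_ltn_trans (n := 2 ^ maxn 1 (up_log 2 n))) ?leq_exp2l ?leq_maxr //.
by rewrite ltn_Pmull // expn_gt0.
Qed.

Lemma up_log_le_bitlen n : up_log 2 n <= bitlen n.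
Proof. by rewrite up_log_min // ltnW // ltn_bitlen. Qed.

Lemma up_log_le n : up_log 2 n <= n.
Proof. by rewrite up_log_min // ltnW // ltn_expl. Qed.

Fixpoint bits (b x : nat) : bitseq :=
  if b is b'.+1 then odd x :: bits b' x./2 else [::].

Definition nat_of_bits : bitseq -> nat :=
  foldr (fun (a : bool) m => a + m.*2) 0.

Lemma size_bits b x : size (bits b x) = b.
Proof. by elim: b x => //= b IHb x; rewrite IHb. Qed.

Lemma bitsK b x : x < 2 ^ b -> nat_of_bits (bits b x) = x.
Proof.
elim: b x => [|b IHb] x /=; first by case: x.
by rewrite expnS => x_lt; rewrite IHb ?odd_double_half //; lia.
Qed.

(** * Cover-free families from polynomials over a finite field *)

Section CoverFree.
Local Open Scope ring_scope.
Variables (F : finFieldType) (k : nat).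

(** Colors index coefficient vectors; the default is reached only from [#|F| ^ k.+1] on. *)
Definition color_poly (x : nat) : {poly F} :=
  let f := nth [ffun=> 0] (enum {: {ffun 'I_k.+1 -> F}}) x in
  \poly_(i < k.+1) f (inord i).

Lemma size_color_poly x : (size (color_poly x) <= k.+1)%N.
Proof. exact: size_poly. Qed.

Lemma color_poly_inj (x y : nat) : (x < #|F| ^ k.+1)%N ->
  (y < #|F| ^ k.+1)%N -> color_poly x = color_poly y -> x = y.
Proof.
have <- : #|{: {ffun 'I_k.+1 -> F}}| = (#|F| ^ k.+1)%N.
  by rewrite card_ffun card_ord.
rewrite cardE => x_lt y_lt /polyP eq_xy.
apply/eqP; rewrite -(nth_uniq [ffun=> 0] x_lt y_lt (enum_uniq _)).
apply/eqP/ffunP => i; have := eq_xy i.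
by rewrite !coef_poly !ltn_ord inord_val.
Qed.

(* The product of the differences with the polynomials of [s] is a nonzero
   polynomial of degree less than #|F|, so it does not vanish everywhere. *)
Lemma uncovered_point (x : nat) (s : seq nat) (d : nat) :
  (d * k < #|F|)%N -> (size s <= d)%N -> (x < #|F| ^ k.+1)%N ->
  {in s, forall y, (y < #|F| ^ k.+1)%N} -> x \notin s ->
  exists a, all (fun y => (color_poly x).[a] != (color_poly y).[a]) s.
Proof.
move=> q_gt size_s x_lt s_lt x_notin.
pose P := \prod_(y <- s) (color_poly x - color_poly y).
have P_neq0 : P != 0.
  rewrite prodf_seq_neq0; apply/allP => y y_in; rewrite subr_eq0; apply/eqP => eq_xy.
  by case/negP: x_notin; rewrite (color_poly_inj x_lt (s_lt y y_in) eq_xy).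
have size_P : (size P <= (size s * k).+1)%N.
  rewrite /P {P P_neq0 size_s x_notin s_lt}; elim: s => [|y s IHs].
    by rewrite big_nil size_poly1.
  rewrite big_cons (leq_trans (size_polyMleq _ _)) //.
  have : (size (color_poly x - color_poly y)%R <= k.+1)%N.
    rewrite (leq_trans (size_polyD _ _)) // size_polyN geq_max.
    by rewrite !size_color_poly.
  by move: IHs => /=; lia.
have [a Pa|noroot] := pickP (fun a => ~~ root P a).
  exists a; apply/allP => y y_in; apply: contra Pa => /eqP eq_a.
  rewrite /root horner_prod prodf_seq_eq0; apply/hasP; exists y => //=.
  by rewrite hornerD hornerN eq_a subrr.
have := max_poly_roots P_neq0 (rs := enum F).
rewrite enum_uniq -cardE => /(_ _ isT) lt_size.
have /lt_size : all (root P) (enum F).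
  by apply/allP => a _; have := noroot a => /negbFE.
rewrite ltnNge (leq_trans size_P) // (leq_ltn_trans _ q_gt) //.
by rewrite leq_mul2r size_s orbT.
Qed.

End CoverFree.

Definition valid_view (m d x : nat) (s : seq nat) : Prop :=
  [/\ x < m, {in s, forall y, y < m}, x \notin s & size s <= d].

(* One step of Linial's color reduction. A vertex needs to know only the colors
   of its out-neighbors: its new color lies in its own set of the cover-free
   family, but in none of the sets of its out-neighbors. *)
Lemma linial (d k e : nat) :
  {g : nat -> seq nat -> nat | 0 < e -> d * k < 2 ^ e ->
   let m := 2 ^ (e * k.+1) in
   (forall x s, valid_view m d x s -> g x s < 2 ^ (2 * e)) /\
   forall x s y s', valid_view m d x s -> valid_view m d y s' -> y \in s ->
     g x s <> g y s'}.
Proof.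
(* For [e = 0] there is no field with [2 ^ e] elements, and the specification is vacuous. *)
have [e_gt0|] := boolP (0 < e); last by exists (fun _ _ => 0).
have [F _ cardF] := pPrimePowerField (isT : prime 2) e_gt0.
pose point x s := odflt 0%R
  [pick a | all (fun y => (color_poly F k x).[a] != (color_poly F k y).[a])%R s].
(* A new color is a point of the graph of the polynomial. Equal new colors would give two
   polynomials that agree at the chosen point, which that point excludes. *)
pose g x s := let a := point x s in
  enum_rank (a, (color_poly F k x).[a])%R : nat.
exists g => _ q_gt m.
have pointP x s : valid_view m d x s ->
    {in s, forall y, (color_poly F k x).[point x s] !=
                     (color_poly F k y).[point x s]}%R.
  case=> x_lt s_lt x_notin size_s.
  move: x_lt s_lt; rewrite /m expnM -cardF => x_lt s_lt.
  rewrite -cardF in q_gt.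
  have [a a_ok] := uncovered_point q_gt size_s x_lt s_lt x_notin.
  rewrite /point; case: pickP => [b /allP//|/(_ a)].
  by rewrite a_ok.
split=> [x s _|x s y s' x_ok y_ok y_in].
  by rewrite (leq_trans (ltn_ord _)) // card_prod cardF mul2n -addnn expnD.
move/val_inj/enum_rank_inj => [eq_pt]; rewrite -eq_pt => eq_val.
by have := pointP x s x_ok y y_in; rewrite eq_val eqxx.
Qed.

(** * Local ratio inequalities from fixed-point equations *)

Section LocalRatio.
Variables (V : finType) (a : rel V) (W r : V -> nat) (x : pred V).
Hypothesis r_fix : forall v, r v = W v - \sum_(u | a u v) r u.
Hypothesis x_fix : forall v, x v = (0 < r v) && ~~ [exists u, a v u && x u].

Let exchange (J : pred V) :
  \sum_(v | J v) r v + \sum_(v | J v) \sum_(u | a u v) r u =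
  \sum_u r u * (J u + #|[set v | J v && a u v]|).
Proof.
rewrite (exchange_big_dep predT) //= (big_mkcond J) -big_split /=.
apply: eq_bigr => u _; rewrite mulnDr; congr (_ + _).
  by case: (J u); rewrite ?muln1 ?muln0.
by rewrite sum_nat_const mulnC cardsE.
Qed.

(** Clipping can only increase [r v], so [W v] is at most [r v] plus the residuals of the
    in-neighbors. Double counting then charges [r u] at most [D] times. *)
Lemma local_ratio_upper (J : pred V) D :
  (forall u, J u + #|[set v | J v && a u v]| <= D) ->
  \sum_(v | J v) W v <= D * \sum_u r u.
Proof.
move=> J_le; apply: (@leq_trans (\sum_(v | J v) (r v + \sum_(u | a u v) r u))).
  by apply: leq_sum => v _; rewrite addnC -leq_subLR -r_fix.
rewrite big_split /= exchange mulnC big_distrl /=.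
by apply: leq_sum => u _; rewrite leq_mul2l J_le orbT.
Qed.

(** A selected vertex has a positive residual, so nothing was clipped there. Each [u] with [r u > 0]
    is counted at least once: it is selected or has a selected out-neighbor. *)
Lemma local_ratio_lower : \sum_u r u <= \sum_(v | x v) W v.
Proof.
apply: (@leq_trans (\sum_(v | x v) (r v + \sum_(u | a u v) r u))); last first.
  apply: leq_sum => v; rewrite x_fix => /andP[rv_gt0 _].
  by have := r_fix v; lia.
rewrite big_split /= exchange; apply: leq_sum => u _.
have [->//|ru_neq0] := eqVneq (r u) 0.
rewrite leq_pmulr // addn_gt0 lt0b; have [//|xu] := boolP (x u).
move: xu; rewrite x_fix lt0n ru_neq0 negbK => /existsP[v /andP[auv xv]].
by apply/card_gt0P; exists v; rewrite inE xv.
Qed.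

End LocalRatio.

(** Induction on the rank: once all smaller ranks stand still, a vertex stands still one round
    later. *)
Lemma stabilize (V S : Type) (s : nat -> V -> S) (rank : V -> nat) (t0 : nat) :
  (forall t v, t0 <= t ->
     (forall u, rank u < rank v -> s t.+1 u = s t u) ->
     s t.+2 v = s t.+1 v) ->
  forall t v, t0 + rank v < t -> s t.+1 v = s t v.
Proof.
move=> step t v; have [m] := ubnP (rank v).
elim: m => // m IHm in t v *; case: t => // t rank_v t_gt.
apply: step => [|u rank_u]; first by lia.
by apply: IHm; lia.
Qed.

(** * Vertex values and their encoding as messages *)

(** Index 1 refers to the pass over arcs of increasing color, index 2 to the pass over arcs of
    decreasing color among the vertices selected first. *)
Record values := Values {
  color : nat; res1 : nat; sel1 : bool; res2 : nat; sel2 : bool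
}.

Definition encode (b : nat) (x : values) : bitseq :=
  [:: sel1 x, sel2 x & bits b (color x) ++ bits b (res1 x) ++ bits b (res2 x)].

Definition decode (b : nat) (m : bitseq) : values :=
  let s := drop 2 m in
  Values (nat_of_bits (take b s)) (nat_of_bits (take b (drop b s)))
    (nth false m 0) (nat_of_bits (drop b (drop b s))) (nth false m 1).

Definition values_fit (b : nat) (x : values) : bool :=
  [&& color x < 2 ^ b, res1 x < 2 ^ b & res2 x < 2 ^ b].

Lemma size_encode b x : size (encode b x) = 3 * b + 2.
Proof. by rewrite /= !size_cat !size_bits; lia. Qed.

Lemma encodeK b x : values_fit b x -> decode b (encode b x) = x.
Proof.
case: x => cx r1 s1 r2 s2 /and3P[/= c_lt r1_lt r2_lt].
rewrite /decode /= drop0 take_size_cat ?size_bits //.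
rewrite !drop_size_cat ?size_bits // take_size_cat ?size_bits //.
by rewrite !bitsK.
Qed.

(** * Color lengths, message width and number of rounds *)

Section ColorSchedule.
Variables (c n d : nat).

(** A constant depending only on [c], large enough to dominate both [2 * c] and
    [4 * bitlen slack + 8]. *)
Definition slack := 2 ^ (c + 5).

(** Since [d] may far exceed [n], the cap keeps color lengths in O(log n). *)
Definition degree_bound := minn d n.

Definition target_bits := 4 * trunc_log 2 degree_bound + slack.

(* The number of bits of the colors after [t] rounds: polynomials of degree at
   most [L] over the field with [2 ^ bitlen (D * L)] elements suffice to
   represent all colors of [L] bits, and a new color is a pair of elements. *)
Definition next_bits (L : nat) :=
  if L <= target_bits then L else 2 * bitlen (degree_bound * L).

Definition color_bits (t : nat) := iter t next_bits (c * bitlen n).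

(** From target length, one more step with polynomials of constant degree [slack] needs a field of
    size only O(d), hence O(d^2) colors. *)
Definition palette_bits := 2 * bitlen (degree_bound * slack).

(** The kind of step depends only on [t], [n] and [d], so all vertices switch simultaneously. *)
Definition recolor (t x : nat) (outs : seq nat) : nat :=
  let L := color_bits t in
  if t < log_star n then
    if L <= target_bits then x
    else sval (linial degree_bound L (bitlen (degree_bound * L))) x outs
  else if t == log_star n then
    sval (linial degree_bound slack (bitlen (degree_bound * slack))) x outs
  else x.

Definition width := (4 + 2 * slack) * bitlen n.

(** The coloring rounds are followed by four stabilization phases, for [res1], [sel1], [res2] and
    [sel2], each one round longer than the palette size. *)
Definition total_rounds := (log_star n).+1 + 4 * (2 ^ palette_bits).+1.

Lemma slack_ge : 32 <= slack /\ 2 * c <= slack.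
Proof.
rewrite /slack expnD; have : c < 2 ^ c by rewrite ltn_expl.
by set p := 2 ^ c; change (2 ^ 5) with 32; lia.
Qed.

Lemma slack_growth : 4 * bitlen slack + 8 <= slack.
Proof.
rewrite /bitlen trunc_expnK // /slack expnD; have : c < 2 ^ c by rewrite ltn_expl.
by set p := 2 ^ c; change (2 ^ 5) with 32; lia.
Qed.

(** If [L <= degree_bound], one step reaches the target. Otherwise the new length is at most
    [4 * bitlen L], logarithmic in the old one. *)
Lemma next_bits_le L x : L <= maxn target_bits (slack * maxn 1 x) ->
  next_bits L <= maxn target_bits (slack * maxn 1 (up_log 2 x)).
Proof.
rewrite /next_bits; case: (leqP L target_bits) => [L_le _|L_gt]; first by rewrite leq_max L_le.
rewrite leq_max [L <= _]leqNgt L_gt /= => L_le; rewrite leq_max.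
have [slack_ge32 _] := slack_ge.
have [L_leD|L_gtD] := leqP L degree_bound.
  have := bitlenM degree_bound L; have := leq_bitlen L_leD.
  by rewrite /target_bits /bitlen; lia.
apply/orP; right.
have := bitlenM degree_bound L; have := leq_bitlen (ltnW L_gtD).
have := leq_bitlen L_le; have := bitlenM slack (maxn 1 x).
have := bitlen_up_log (maxn 1 x).
have -> : up_log 2 (maxn 1 x) = up_log 2 x.
  by case: x {L_le} => [|x]; rewrite ?up_log0 ?up_log1 // (maxn_idPr _).
have := slack_growth; set y := maxn 1 (up_log 2 x).
have y_gt0 : 0 < y by rewrite leq_max.
move=> growth *; apply: (@leq_trans ((4 * bitlen slack + 8) * y)); last first.
  by rewrite leq_mul2r growth orbT.
by rewrite mulnDl -mulnA; have := leq_pmulr (bitlen slack) y_gt0; lia.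
Qed.

Lemma color_bits_le t : color_bits t <=
  maxn target_bits (slack * maxn 1 (iter t (up_log 2) (up_log 2 n))).
Proof.
elim: t => [|t IHt]; last exact: next_bits_le.
rewrite leq_max; apply/orP; right; rewrite /color_bits /=.
have [_ slack_ge2c] := slack_ge.
apply: (@leq_trans (2 * c * maxn 1 (up_log 2 n))); last first.
  by rewrite leq_mul2r slack_ge2c orbT.
by rewrite [2 * c]mulnC -mulnA leq_mul2l bitlen_up_log orbT.
Qed.

Lemma color_bits_final : color_bits (log_star n) <= target_bits.
Proof.
have := color_bits_le (log_star n).
have -> : maxn 1 (iter (log_star n) (up_log 2) (up_log 2 n)) = 1.
  apply/maxn_idPl; rewrite -iterSr /= (leq_trans (up_log_le _)) //.
  by rewrite /log_star; case: ex_minnP.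
by rewrite muln1 leq_max /target_bits => /orP[//|/leq_trans]; apply; lia.
Qed.

Lemma bitlen_degree_bound : bitlen degree_bound <= bitlen n.
Proof. by rewrite leq_bitlen ?geq_minr. Qed.

Lemma color_bits_width t : color_bits t <= width.
Proof.
apply: leq_trans (color_bits_le t) _; rewrite geq_max /width.
have b_gt0 := bitlen_gt0 n; apply/andP; split.
  have := bitlen_degree_bound; rewrite mulnDl -mulnA.
  have := leq_pmulr slack b_gt0; rewrite /target_bits.
  by move: (slack * _) => p; rewrite /bitlen; lia.
apply: leq_mul; first by lia.
rewrite geq_max b_gt0 (leq_trans _ (up_log_le_bitlen n)) //.
elim: t => //= t; apply: leq_trans; exact: up_log_le.
Qed.

Lemma palette_bits_width : palette_bits <= width.
Proof.
rewrite /palette_bits /width; have b_gt0 := bitlen_gt0 n.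
have := bitlenM degree_bound slack; have := bitlen_degree_bound.
have := slack_growth; have := leq_pmulr slack b_gt0.
rewrite mulnDl -mulnA; move: (slack * bitlen n) => p; lia.
Qed.

Lemma total_rounds_le : 0 < d ->
  total_rounds <= (5 + 16 * slack ^ 2) * (d ^ 2 + log_star n).
Proof.
move=> d_gt0; have slack_gt0 : 0 < slack by rewrite expn_gt0.
have : 2 ^ palette_bits <= 4 * (slack ^ 2 * d ^ 2).
  apply: (@leq_trans ((2 * (d * slack)) ^ 2)); last by rewrite !expnMn mulnCA; lia.
  rewrite /palette_bits mulnC expnM leq_exp2r //.
  apply: leq_trans (exp_bitlen_le _); last by rewrite muln_gt0 d_gt0.
  by rewrite leq_exp2l // leq_bitlen // leq_mul2r geq_minl orbT.
(* The five extra rounds from the successors are absorbed by [d ^ 2 >= 1]. *)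
have := leq_pmulr 5 (_ : 0 < d ^ 2); rewrite expn_gt0 d_gt0 => /(_ isT).
rewrite /total_rounds mulnDl !mulnDr -mulnA.
lia.
Qed.

End ColorSchedule.

(* An entry [((o, i), x)] of [nb] stands for a link that carries an outgoing
   (resp. incoming) arc iff [o] (resp. [i]), to a neighbor with values [x].
   Residual weights are clipped at 0 by the truncated subtraction. *)
Definition update (newcolor : nat -> seq nat -> nat) (W : nat) (own : values)
    (nb : seq ((bool * bool) * values)) : values :=
  {| color := newcolor (color own) [seq color p.2 | p <- nb & p.1.1];
     res1 := W - \sum_(p <- nb | p.1.2 && (color p.2 < color own)) res1 p.2;
     sel1 := (0 < res1 own) &&
       ~~ has (fun p => [&& p.1.1, color own < color p.2 & sel1 p.2]) nb;
     res2 := (if sel1 own then W else 0) -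
       \sum_(p <- nb | p.1.2 && (color own < color p.2)) res2 p.2;
     sel2 := (0 < res2 own) &&
       ~~ has (fun p => [&& p.1.1, color p.2 < color own & sel2 p.2]) nb |}.

(** * The run on a graph: coloring, stabilization, approximation *)

Section Run.
Variables (V : finType) (arc : rel V) (c d : nat).
Variables (W ident : V -> nat) (ports : V -> seq V).
Hypothesis arc_irr : irreflexive arc.
Hypothesis out_degree_le : forall v, out_degree arc v <= d.
Hypothesis ident_inj : injective ident.
Hypothesis ident_lt : forall v, ident v < 2 ^ (c * bitlen #|V|).
Hypothesis ports_ok : port_numbering arc ports.

Let n := #|V|.

(** An idealized execution in which neighbors' values are read directly instead of being decoded
    from messages. *)
Fixpoint run (t : nat) : V -> values :=
  if t is t'.+1 then fun v =>
    update (recolor c n d t') (W v) (run t' v)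
      [seq ((arc v u, arc u v), run t' u) | u <- ports v]
  else fun v => Values (ident v) 0 false 0 false.

Notation col t := (fun v => color (run t v)).

Let links_with (a : rel V) v (P : pred V) (F : V -> nat) :
  (forall u, a u v -> adj arc v u) ->
  \sum_(u <- ports v | a u v && P u) F u = \sum_(u | a u v && P u) F u.
Proof.
move=> a_adj; have [ports_uniq portsE] := ports_ok v.
rewrite -big_filter big_uniq ?filter_uniq //; apply: eq_bigl => u.
rewrite mem_filter portsE inE andbC; case: (boolP (a u v)) => [/a_adj->//|_].
by rewrite andbF.
Qed.

Let has_links v (P : pred V) :
  (forall u, P u -> adj arc v u) -> has P (ports v) = [exists u, P u].
Proof.
move=> P_adj; have [_ portsE] := ports_ok v.
apply/hasP/existsP => [[u _ Pu]|[u Pu]]; exists u => //.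
by rewrite portsE inE P_adj.
Qed.

Lemma color_run t v : color (run t.+1 v) = recolor c n d t (color (run t v))
  [seq color (run t u) | u <- ports v & arc v u].
Proof. by rewrite /= filter_map -map_comp. Qed.

Lemma res1_run t v : res1 (run t.+1 v) =
  W v - \sum_(u | arc u v && (color (run t u) < color (run t v))) res1 (run t u).
Proof.
by rewrite /= big_map links_with // => u auv; rewrite /adj auv orbT.
Qed.

Lemma res2_run t v : res2 (run t.+1 v) = (if sel1 (run t v) then W v else 0) -
  \sum_(u | arc u v && (color (run t v) < color (run t u))) res2 (run t u).
Proof.
by rewrite /= big_map links_with // => u auv; rewrite /adj auv orbT.
Qed.

Lemma sel1_run t v : sel1 (run t.+1 v) = (0 < res1 (run t v)) &&
  ~~ [exists u, [&& arc v u, color (run t v) < color (run t u) & sel1 (run t u)]].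
Proof.
by rewrite /= has_map has_links //= => u /and3P[avu _ _]; rewrite /adj avu.
Qed.

Lemma sel2_run t v : sel2 (run t.+1 v) = (0 < res2 (run t v)) &&
  ~~ [exists u, [&& arc v u, color (run t u) < color (run t v) & sel2 (run t u)]].
Proof.
by rewrite /= has_map has_links //= => u /and3P[avu _ _]; rewrite /adj avu.
Qed.

Let outs t v := [seq color (run t u) | u <- ports v & arc v u].

Lemma mem_outs t v u : arc v u -> color (run t u) \in outs t v.
Proof.
move=> avu; apply: map_f; rewrite mem_filter avu (ports_ok v).2 inE.
by rewrite /adj avu.
Qed.

Lemma outsP t v x : x \in outs t v -> exists2 u, arc v u & x = color (run t u).
Proof.
by case/mapP => u; rewrite mem_filter => /andP[avu _] ->; exists u.
Qed.

Lemma size_outs t v : size (outs t v) <= degree_bound n d.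
Proof.
have [ports_uniq portsE] := ports_ok v.
have uniq_outs : uniq [seq u <- ports v | arc v u] by rewrite filter_uniq.
rewrite /degree_bound leq_min size_map -(card_uniqP uniq_outs) max_card andbT.
apply: leq_trans (out_degree_le v); rewrite subset_leq_card //.
by apply/subsetP => u; rewrite mem_filter inE => /andP[].
Qed.

Definition proper_coloring t b :=
  (forall v, color (run t v) < 2 ^ b) /\
  forall u v, adj arc u v -> color (run t u) <> color (run t v).

(** On each arc the tail avoids the new color of the head, which separates the two endpoints
    whatever the head does. *)
Lemma linial_round t b k e :
  (forall v, color (run t.+1 v) =
     sval (linial (degree_bound n d) k e) (color (run t v)) (outs t v)) ->
  0 < e -> degree_bound n d * k < 2 ^ e -> b <= e * k.+1 ->
  proper_coloring t b -> proper_coloring t.+1 (2 * e).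
Proof.
case: linial => g gP; rewrite [sval _]/= => colorE e_gt0 q_gt b_le [col_lt col_neq].
have [g_lt g_neq] := gP e_gt0 q_gt.
have validP v :
    valid_view (2 ^ (e * k.+1)) (degree_bound n d) (color (run t v)) (outs t v).
  have lt u : color (run t u) < 2 ^ (e * k.+1).
    by rewrite (leq_trans (col_lt u)) // leq_exp2l.
  split=> // [x /outsP[u _ ->] //||]; last exact: size_outs.
  apply/negP => /outsP[u avu]; apply: col_neq.
  by rewrite /adj avu.
have neq u v : arc u v -> color (run t.+1 u) <> color (run t.+1 v).
  move=> auv; rewrite !colorE; apply: g_neq => //; exact: mem_outs.
split=> [v|u v /orP[/neq//|/neq neq_vu /esym//]].
by rewrite colorE; apply: g_lt.
Qed.

Lemma proper_color_bits t :
  t <= log_star n -> proper_coloring t (color_bits c n d t).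
Proof.
elim: t => [_|t IHt t_lt].
  split=> [v|u v auv /ident_inj uv]; first exact: ident_lt.
  by move: auv; rewrite uv /adj arc_irr.
have {IHt} := IHt (ltnW t_lt); rewrite /proper_coloring /color_bits iterS.
rewrite -/(color_bits c n d t) /next_bits; set L := color_bits c n d t.
have colorE := fun v => color_run t v.
case: leqP => [L_le|L_gt].
  have same v : color (run t.+1 v) = color (run t v).
    by rewrite colorE /recolor t_lt L_le.
  by case=> lt neq; split=> [v|u v]; rewrite !same //; apply: neq.
apply: (@linial_round t L L) => // [v||]; last first.
- by rewrite (leq_trans (leqnSn L)) // leq_pmull.
- exact: ltn_bitlen.
by rewrite colorE /recolor t_lt leqNgt L_gt.
Qed.

Let t0 := (log_star n).+1.

Lemma proper_palette : proper_coloring t0 (palette_bits c n d).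
Proof.
apply: (@linial_round _ (color_bits c n d (log_star n)) (slack c)) => //.
- by move=> v; rewrite color_run /recolor ltnn eqxx.
- exact: ltn_bitlen.
(* With [l] the logarithm of the degree bound and [K] the slack, [4 * l + K <= l.+1 * K], and [l.+1]
   is at most the field exponent [e]. *)
- apply: leq_trans (color_bits_final c n d) _; rewrite /target_bits mulnS.
  have : bitlen (degree_bound n d) <= bitlen (degree_bound n d * slack c).
    by rewrite leq_bitlen // leq_pmulr // expn_gt0.
  have [slack_ge32 _] := slack_ge c.
  rewrite {1}/bitlen; move: (bitlen (_ * _)) => e; move: (trunc_log _ _) => l l_lt.
  apply: (@leq_trans (e * slack c)); last exact: leq_addl.
  apply: (@leq_trans (l.+1 * slack c)); last by rewrite leq_mul2r l_lt orbT.
  by move: slack_ge32; move: (slack c) => K; nia.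
- exact: proper_color_bits.
Qed.

Lemma color_stable t v : t0 <= t -> color (run t v) = color (run t0 v).
Proof.
elim: t => // t IHt; rewrite leq_eqVlt => /predU1P[->//|t_ge].
have t_gt : log_star n < t by [].
rewrite color_run -IHt // /recolor ltnNge (ltnW t_gt) /=.
by rewrite gtn_eqF.
Qed.

Let M := 2 ^ palette_bits c n d.
Let phi v := color (run t0 v).
Let phi_lt v : phi v < M. Proof. exact: (proper_palette).1. Qed.

(** On increasing arcs a residual depends on in-neighbors of smaller color, so the color is the
    rank. *)
Lemma res1_stable t v :
  t0 + M.+1 <= t -> res1 (run t.+1 v) = res1 (run t v).
Proof.
move=> t_ge; apply: (@stabilize _ _ (fun t v => res1 (run t v)) phi t0).
  move=> {v t_ge}t v t_ge IH; rewrite !res1_run !color_stable ?(leqW t_ge) //.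
  congr (_ - _); apply: eq_big => [u|u]; rewrite !color_stable ?(leqW t_ge) //.
  by case/andP=> _; exact: IH.
by have := phi_lt v; lia.
Qed.

(** Selection looks at out-neighbors, here of larger color, so the rank is reversed; it starts once
    [res1] is stable. *)
Lemma sel1_stable t v :
  t0 + 2 * M.+1 <= t -> sel1 (run t.+1 v) = sel1 (run t v).
Proof.
move=> t_ge; apply: (@stabilize _ _ (fun t v => sel1 (run t v))
  (fun v => M - phi v) (t0 + M.+1)); last by have := phi_lt v; lia.
move=> {v t_ge}t v t_ge IH; have t_ge0 : t0 <= t by lia.
rewrite !sel1_run res1_stable //; congr (_ && ~~ _).
apply: eq_existsb => u; rewrite !color_stable ?(leqW t_ge0) //.
have [avu|//] := boolP (arc v u); have [lt_uv /=|//] := ltnP.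
by apply: IH; have := phi_lt u; rewrite /phi in lt_uv *; lia.
Qed.

(** On decreasing arcs in-neighbors have larger colors; the base weights are fixed once [sel1] is
    stable. *)
Lemma res2_stable t v :
  t0 + 3 * M.+1 <= t -> res2 (run t.+1 v) = res2 (run t v).
Proof.
move=> t_ge; apply: (@stabilize _ _ (fun t v => res2 (run t v))
  (fun v => M - phi v) (t0 + 2 * M.+1)); last by have := phi_lt v; lia.
move=> {v t_ge}t v t_ge IH; have t_ge0 : t0 <= t by lia.
rewrite !res2_run sel1_stable // !color_stable ?(leqW t_ge0) //.
congr (_ - _); apply: eq_big => [u|u]; rewrite !color_stable ?(leqW t_ge0) //.
case/andP=> _ lt_uv; apply: IH.
by have := phi_lt u; rewrite /phi in lt_uv *; lia.
Qed.

Lemma sel2_stable t v :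
  t0 + 4 * M.+1 <= t -> sel2 (run t.+1 v) = sel2 (run t v).
Proof.
move=> t_ge; apply: (@stabilize _ _ (fun t v => sel2 (run t v)) phi
  (t0 + 3 * M.+1)); last by have := phi_lt v; lia.
move=> {v t_ge}t v t_ge IH; have t_ge0 : t0 <= t by lia.
rewrite !sel2_run res2_stable //; congr (_ && ~~ _).
apply: eq_existsb => u; rewrite !color_stable ?(leqW t_ge0) //.
have [avu|//] := boolP (arc v u); have [lt_uv /=|//] := ltnP.
exact: IH.
Qed.

Let tf := total_rounds c n d.
Let r1 v := res1 (run tf v).
Let x1 v := sel1 (run tf v).
Let r2 v := res2 (run tf v).
Let x2 v := sel2 (run tf v).
Let up : rel V := [rel u v | arc u v && (phi u < phi v)].
Let down : rel V := [rel u v | arc u v && (phi v < phi u)].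
Let W2 v := if x1 v then W v else 0.

Let tf_ge k : k <= 4 -> t0 + k * M.+1 <= tf.
Proof. by move=> k_le; rewrite leq_add2l leq_mul2r k_le orbT. Qed.

Let tf_ge0 : t0 <= tf. Proof. by rewrite (leq_trans _ (@tf_ge 0 isT)) ?addn0. Qed.

Let r1_fix v : r1 v = W v - \sum_(u | up u v) r1 u.
Proof.
have t_ge := @tf_ge 1 isT; rewrite mul1n in t_ge.
(* One more round changes nothing, so the update rule becomes a fixed-point equation. *)
rewrite {1}/r1 -res1_stable // res1_run.
by congr (_ - _); apply: eq_bigl => u; rewrite !color_stable.
Qed.

Let r2_fix v : r2 v = W2 v - \sum_(u | down u v) r2 u.
Proof.
rewrite {1}/r2 -res2_stable ?(@tf_ge 3) // res2_run.
by congr (_ - _); apply: eq_bigl => u; rewrite !color_stable.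
Qed.

Let x1_fix v : x1 v = (0 < r1 v) && ~~ [exists u, up v u && x1 u].
Proof.
rewrite {1}/x1 -sel1_stable ?(@tf_ge 2) // sel1_run; congr (_ && ~~ _).
by apply: eq_existsb => u; rewrite !color_stable //= -andbA.
Qed.

Let x2_fix v : x2 v = (0 < r2 v) && ~~ [exists u, down v u && x2 u].
Proof.
rewrite {1}/x2 -sel2_stable ?(@tf_ge 4) // sel2_run; congr (_ && ~~ _).
by apply: eq_existsb => u; rewrite !color_stable //= -andbA.
Qed.

(** A vertex rejected by the first pass has weight 0 in the second, hence residual 0. *)
Lemma sel2_sel1 v : x2 v -> x1 v.
Proof. by rewrite x2_fix => /andP[]; rewrite r2_fix /W2; case: (x1 v).
Qed.

(** The first pass excludes increasing arcs, the second decreasing ones, and properness excludes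
    equal colors. *)
Lemma sel2_independent : independent arc [set v | sel2 (run tf v)].
Proof.
have noarc u v : x2 u -> x2 v -> ~~ arc u v.
  move=> x2u x2v; apply/negP => auv.
  have [lt|lt|] := ltngtP (phi u) (phi v).
  - have := sel2_sel1 x2u; rewrite x1_fix => /andP[_ /negP[]].
    by apply/existsP; exists v; rewrite /up /= auv lt sel2_sel1.
  - have := x2u; rewrite x2_fix => /andP[_ /negP[]].
    by apply/existsP; exists v; rewrite /down /= auv lt.
  - by apply: proper_palette.2; rewrite /adj auv.
apply/forall_inP => u; rewrite inE => x2u.
apply/forall_inP => v; rewrite inE => x2v.
by rewrite /adj negb_or !noarc.
Qed.

Lemma sel2_weight (I : {set V}) : 0 < d -> independent arc I ->
  \sum_(v in I) W v <= 2 * d ^ 2 * \sum_(v in [set v | sel2 (run tf v)]) W v.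
Proof.
move=> d_gt0 /forall_inP indI.
have outdeg (J : pred V) (a : rel V) u :
    subrel a arc -> #|[set v | J v && a u v]| <= d.
  move=> a_arc; apply: leq_trans (out_degree_le u); rewrite subset_leq_card //.
  by apply/subsetP => v; rewrite !inE => /andP[_ /a_arc].
have up_arc : subrel up arc by move=> u v /andP[].
have down_arc : subrel down arc by move=> u v /andP[].
(* A vertex of [I] has no out-neighbor in [I] and is counted once, within [d] as [0 < d]; any other
   vertex is counted at most [d] times. *)
have step1 : \sum_(v in I) W v <= d * \sum_u r1 u.
  apply: (local_ratio_upper r1_fix) => u; have [uI|_] := boolP (u \in I).
    rewrite (_ : [set v | _] = set0) ?cards0 // -setP.
    move=> v; rewrite !inE; apply/negP => /andP[vI /up_arc auv].
    by have /forall_inP/(_ v vI) := indI u uI; rewrite /adj auv.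
  exact: outdeg.
have step2 : \sum_u r1 u <= \sum_v W2 v.
  by rewrite -big_mkcond; apply: local_ratio_lower r1_fix x1_fix.
(* With all vertices in [J], each is counted once for itself and once per decreasing outgoing
   arc. *)
have step3 : \sum_v W2 v <= d.+1 * \sum_u r2 u.
  apply: (local_ratio_upper r2_fix (J := predT)) => u.
  by rewrite add1n ltnS; apply: outdeg.
have step4 : \sum_u r2 u <= \sum_(v in [set v | sel2 (run tf v)]) W v.
  apply: leq_trans (local_ratio_lower r2_fix x2_fix) _.
  rewrite [leqRHS](eq_bigl x2) => [|v]; last by rewrite inE.
  by apply: leq_sum => v x2v; rewrite /W2 sel2_sel1.
apply: (leq_trans step1); apply: (@leq_trans (d * (d.+1 * \sum_u r2 u))).
  by rewrite leq_mul2l (leq_trans step2) ?orbT.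
by rewrite mulnA leq_mul // -mulnn; nia.
Qed.

Lemma run_fit t v : (forall v, W v < 2 ^ width c n) ->
  values_fit (width c n) (run t v).
Proof.
move=> W_lt; have w_gt0 : 0 < 2 ^ width c n by rewrite expn_gt0.
apply/and3P; split.
- have [t_le|t_gt] := leqP t (log_star n).
    apply: leq_trans ((proper_color_bits t_le).1 v) _.
    by rewrite leq_exp2l // color_bits_width.
  rewrite color_stable //; apply: leq_trans (phi_lt v) _.
  by rewrite leq_exp2l // palette_bits_width.
- case: t => // t; rewrite res1_run; exact: leq_ltn_trans (leq_subr _ _) (W_lt v).
case: t => // t; rewrite res2_run (leq_ltn_trans (leq_subr _ _)) //.
by case: ifP.
Qed.

End Run.

(** * The CONGEST algorithm and its correctness *)

Record vertex_state := VertexState {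
  net_size : nat; degree_cap : nat; weight_units : nat;
  links : seq (bool * bool); clock : nat; current : values
}.

(** Weights are scaled to natural numbers, and every vertex broadcasts all its values. The stored
    link flags are matched with the messages by port order. *)
Definition mwis_algorithm (R : realType) (c : nat) : congest_algorithm R :=
  {| state := vertex_state;
     rounds := total_rounds c;
     init n d ident x ls :=
       VertexState n d (Num.truncn (x * 2%:R ^+ (c * bitlen n))%R) ls 0
         (Values ident 0 false 0 false);
     send s _ := encode (width c (net_size s)) (current s);
     receive s ms :=
       VertexState (net_size s) (degree_cap s) (weight_units s) (links s)
         (clock s).+1
         (update (recolor c (net_size s) (degree_cap s) (clock s))
            (weight_units s) (current s)
            (zip (links s) (map (decode (width c (net_size s))) ms)));
     output s := sel2 (current s) |}.

Theorem theorem5p1 (R : realType) (c : nat) :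
  exists (A : congest_algorithm R) (B C : nat),
  forall (V : finType) (arc : rel V) (d : nat) (w : V -> R)
         (ident : V -> nat) (ports : V -> seq V),
    irreflexive arc ->
    0 < d ->
    (forall v, out_degree arc v <= d) ->
    (forall v, (0 <= w v)%R) ->
    (forall v, binary_representable (c * bitlen #|V|) (w v)) ->
    injective ident ->
    (forall v, ident v < 2 ^ (c * bitlen #|V|)) ->
    port_numbering arc ports ->
    let X' := computed_set A arc d w ident ports in
    [/\ rounds A #|V| d <= C * (d ^ 2 + log_star #|V|),
        messages_bounded A arc d w ident ports (B * bitlen #|V|),
        independent arc X'
      & (opt arc w <= (2 * d ^ 2)%:R * set_weight w X')%R].
Proof.
(* A message has three fields of the common width and two flag bits; the 2 is absorbed by
   [bitlen n >= 1]. *)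
exists (mwis_algorithm R c), (3 * (4 + 2 * slack c) + 2), (5 + 16 * slack c ^ 2).
move=> V arc d w ident ports arc_irr d_gt0 outd w_ge0 w_rep ident_inj ident_lt
  ports_ok X'.
pose scale : R := (2%:R ^+ (c * bitlen #|V|))%R.
pose W v := Num.truncn (w v * scale)%R.
(* Representability makes the scaled weight an integer, so truncation loses nothing. *)
have W_E v : (w v * scale = (W v)%:R)%R /\ W v < 2 ^ width c #|V|.
  have [k k_lt w_k] := w_rep v; rewrite /W /scale w_k natrK; split=> //.
  apply: leq_trans k_lt _; rewrite leq_exp2l // -mulnDl leq_mul2r.
  by have [_] := slack_ge c; lia.
have execE t v : exec (mwis_algorithm R c) arc d w ident ports t v =
    VertexState #|V| d (W v) [seq (arc v u, arc u v) | u <- ports v] t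
      (run arc c d W ident ports t v).
  elim: t v => // t IHt v /=; rewrite IHt /=; congr VertexState; congr update.
  rewrite -map_comp zip_map; apply: eq_map => u /=.
  rewrite /message_from IHt /= encodeK //.
  by apply: run_fit => // v'; have [] := W_E v'.
pose tf := total_rounds c #|V| d.
have X'E : X' = [set v | sel2 (run arc c d W ident ports tf v)].
  by apply/setP => v; rewrite !inE execE.
split.
- exact: total_rounds_le.
- move=> t u v _ _; rewrite /message_from execE size_encode.
  by rewrite /width mulnA mulnDl leq_add2l leq_pmulr.
- by rewrite X'E; apply: sel2_independent.
have scale_gt0 : (0 < scale)%R by rewrite exprn_gt0 // ltr0n.
have weightE (I : {set V}) :
    (set_weight w I * scale = (\sum_(v in I) W v)%:R)%R.
  rewrite /set_weight mulr_suml natr_sum; apply: eq_bigr => v _.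
  by have [] := W_E v.
apply: bigmax_le => [|I indI].
  by rewrite mulr_ge0 ?ler0n // sumr_ge0.
(* Multiplying by the positive scale reduces the real inequality to the one on natural weights. *)
rewrite -(ler_pM2r scale_gt0) -mulrA !weightE -natrM ler_nat X'E.
exact: sel2_weight.
Qed.
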